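(* For every positive integer $n$, $$\int_0^1\int_0^1 -\frac{(x(1-x)y(1-y))^n}{(1-xy)\log (xy)}\,dx\,dy = \binom{2n}{n}\gamma + L_n - A_n,$$ where $L_n$ is the linear form in logarithms $$L_n = \sum_{k=1}^{n}\ \sum_{i=0}^{\min(k-1,\,n-k)}\ \sum_{j=i+1}^{n-i}\binom{n}{i}^2\frac{2}{j}\log(n+k),$$ and where $$A_n = \sum_{i=0}^n\binom{n}{i}^2 H_{n+i}$$ satisfies $d_{2n}A_n\in\mathbf{Z}$.
   Context: Here $\log$ is the natural logarithm. $H_N=\sum_{k=1}^N k^{-1}$ is the $N$th harmonic number, and Euler's constant is $\gamma := \lim_{N\to\infty}(H_N-\log N)$. For a positive integer $m$, $d_m$ denotes the least common multiple of $1,2,\ldots,m$. *)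

(* Defs.v *)
From HB Require Import structures.
From mathcomp Require Export all_boot all_order all_algebra.
From mathcomp Require Export all_classical all_reals all_analysis.
Export Order.TTheory GRing.Theory Num.Theory numFieldNormedType.Exports.

Set Implicit Arguments.
Unset Strict Implicit.
Unset Printing Implicit Defensive.

Local Open Scope classical_set_scope.
Local Open Scope ring_scope.

(* Not the library's [harmonic], which is the sequence of terms 1 / (n + 1). *)
Definition harmonic_number (R : realType) (N : nat) : R :=
  \sum_(1 <= k < N.+1) k%:R^-1.

Definition euler_gamma (R : realType) : R :=
  lim ((fun N : nat => harmonic_number R N - ln (N%:R : R)) @ \oo).

Definition lcm_upto (m : nat) : nat := \big[lcmn/1%N]_(1 <= k < m.+1) k.

Definition log_form (R : realType) (n : nat) : R :=
  \sum_(1 <= k < n.+1)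
    \sum_(0 <= i < (minn k.-1 (n - k)).+1)
      \sum_(i.+1 <= j < (n - i).+1)
        ('C(n, i)%:R ^+ 2 * (2 / j%:R) * ln ((n + k)%:R : R)).

Definition harmonic_form (R : realType) (n : nat) : R :=
  \sum_(0 <= i < n.+1) 'C(n, i)%:R ^+ 2 * harmonic_number R (n + i).

(* [ln] is 0 on nonpositive arguments and [0^-1 = 0], so this is total; on the unit
   square the conventions only matter on the null set where [x * y] is 0 or 1. *)
Definition integrand (R : realType) (n : nat) (x y : R) : R :=
  - ((x * (1 - x) * y * (1 - y)) ^+ n / ((1 - x * y) * ln (x * y))).

(* Main.v *)
Require Import Defs.
From mathcomp Require Import all_boot all_order all_algebra.
From mathcomp Require Import all_classical all_reals all_analysis.
From mathcomp Require Import measurable_realfun ring lra zify.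

Set Implicit Arguments.
Unset Strict Implicit.
Unset Printing Implicit Defensive.

Local Open Scope classical_set_scope.
Local Open Scope ring_scope.

(** For [0 < u < 1] one has [- 1 / ln u = \int_0^oo u^t dt] and
    [1 / (1 - u) = \sum_j u^j]. Applied to [u = x * y] this writes the integrand
    as a sum over [v >= n] of [\int_v^oo (x y)^t ((1 - x) (1 - y))^n dt], in
    which [x] and [y] separate. Everything is nonnegative, so sum and integrals
    commute ([integral_swap], [integral_integrand]), and since
    [\int_0^1 x^t (1 - x)^n dx = \sum_k (-1)^k C(n, k) / (t + 1 + k)]
    ([integral_beta_kernel]) the double integral equals
    [\sum_(v >= n) \int_v^oo (\sum_k (-1)^k C(n, k) / (t + 1 + k))^2 dt].

    The square has the partial fraction expansion
    [\sum_k (C(n, k)^2 / (t + 1 + k)^2 + r_k / (t + 1 + k))]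
    ([sqr_partial_fraction]). The residues
    [r_k = 2 C(n, k)^2 (H_k - H_(n - k))] ([residueE]) sum to [0], so that the
    logarithms in the antiderivative cancel at infinity and each tail integral is
    [\sum_k (C(n, k)^2 / (v + 1 + k) - r_k ln (v + 1 + k))]
    ([integral_beta_sum_sqr]).

    Summing over [n <= v < M], the first parts give
    [\sum_k C(n, k)^2 H_(M + k) - A_n], while the logarithms telescope, because
    [\sum_k r_k = 0] again, to boundary terms at both ends
    ([sum_tail_int]). Those at the lower end are [L_n] ([log_form_residue]); those
    at the upper end are [- \sum_k k r_k] times [ln M] up to a vanishing error. As
    [\sum_k k r_k = C(2 n, n) = \sum_k C(n, k)^2] ([sum_natM_residue]), the
    divergent parts combine to [C(2 n, n) (H_M - ln M)], whose limit is
    [C(2 n, n)] times Euler's constant ([cvg_sum_tail_int]).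

    Integrality of [d_(2n) A_n] is immediate: only denominators at most [2 n]
    occur ([harmonic_form_int]). *)

(** * Partial fractions of the squared beta integral *)

Section PartialFraction.
Variable R : realType.
Implicit Types (n k l : nat) (z t : R).

Definition altbin n k : R := (-1) ^+ k * 'C(n, k)%:R.

(** As [0^-1 = 0], evaluating at [z = k] drops the term [l = k]; so
    [alt_cauchy n k%:R] is the sum over [l != k] that partial fractions produce. *)
Definition alt_cauchy n z : R := \sum_(l < n.+1) altbin n l / (l%:R - z).

Lemma sqr_altbin n k : altbin n k ^+ 2 = 'C(n, k)%:R ^+ 2.
Proof. by rewrite /altbin exprMn sqrr_sign mul1r. Qed.

Lemma altbin_sub n k : (k <= n)%N -> altbin n (n - k) = (-1) ^+ n * altbin n k.
Proof.
move=> kn; rewrite /altbin bin_sub // mulrA -exprD; congr (_ * _).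
by rewrite -[RHS]signr_odd -[LHS]signr_odd oddB // oddD.
Qed.

Lemma sum_altbin n : (0 < n)%N -> \sum_(k < n.+1) altbin n k = 0.
Proof.
move=> n0; rewrite [LHS](_ : _ = (1 - 1) ^+ n).
  by rewrite subrr expr0n gtn_eqF.
rewrite exprDn; apply: eq_bigr => i _.
by rewrite /altbin expr1n mul1r mulr_natr.
Qed.

Lemma sum_altbin_sqr n : \sum_(k < n.+1) altbin n k ^+ 2 = 'C(2 * n, n)%:R.
Proof.
rewrite mul2n -addnn -binomial.Vandermonde natr_sum; apply: eq_bigr => i _.
by rewrite sqr_altbin natrM bin_sub // -ltnS.
Qed.

(** Pascal's rule. Having a real argument [z] lets the recurrence reach
    [z = -1], outside the range of the binomial coefficients. *)
Lemma alt_cauchyS n z :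
  alt_cauchy n.+1 z = alt_cauchy n z - alt_cauchy n (z - 1).
Proof.
rewrite /alt_cauchy big_ord_recl [in RHS]big_ord_recl /= -addrA.
congr (_ + _); first by rewrite /altbin !bin0.
rewrite -sumrN.
transitivity (\sum_(i < n.+1) altbin n i.+1 / (i.+1%:R - z)
              - \sum_(i < n.+1) altbin n i / (i%:R - (z - 1))).
  rewrite -sumrB; apply: eq_bigr => i _.
  rewrite /altbin binS natrD exprS -natr1.
  have -> : i%:R + 1 - z = i%:R - (z - 1) by ring.
  by rewrite mulrDr mulrDl mulN1r !mulNr.
rewrite sumrN; congr (_ - _).
by rewrite big_ord_recr /= {2}/altbin bin_small // mulr0 mul0r addr0.
Qed.

(** The absorption identity [C(n, l) / (l + 1) = C(n + 1, l + 1) / (n + 1)] turns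
    the sum into the alternating row sum of [C(n + 1, _)] without its first term. *)
Lemma alt_cauchyN1 n : alt_cauchy n (-1) = n.+1%:R^-1.
Proof.
have := sum_altbin (ltn0Sn n).
rewrite big_ord_recl {1}/altbin bin0 expr0 mulr1 => /eqP.
rewrite addrC addr_eq0 => /eqP h.
have {}h : 1 = \sum_(i < n.+1) - altbin n.+1 (lift ord0 i).
  by rewrite sumrN h opprK.
rewrite -[RHS]mul1r [X in _ = X / _]h mulr_suml.
apply: eq_bigr => i _; rewrite /altbin lift0 opprK exprS.
have h2 : i.+1%:R * 'C(n.+1, i.+1)%:R = n.+1%:R * 'C(n, i)%:R :> R.
  by rewrite -!natrM -mul_bin_diag.
rewrite mulN1r mulNr opprK -!mulrA natr1; congr (_ * _).
apply/eqP; rewrite eqr_div ?pnatr_eq0 //; apply/eqP.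
by rewrite mulrC -h2 mulrC.
Qed.

Lemma alt_cauchy_refl n z :
  alt_cauchy n (n%:R - z) = - ((-1) ^+ n * alt_cauchy n z).
Proof.
rewrite /alt_cauchy (reindex_inj rev_ord_inj) /= mulr_sumr -sumrN.
apply: eq_bigr => i _; have li : (i <= n)%N by rewrite -ltnS.
rewrite subSS altbin_sub // natrB //.
have -> : n%:R - i%:R - (n%:R - z) = - (i%:R - z) by ring.
by rewrite invrN mulrN !mulrA.
Qed.

Lemma harmonicS n : harmonic_number R n.+1 = harmonic_number R n + n.+1%:R^-1.
Proof. by rewrite /harmonic_number big_nat_recr. Qed.

Lemma harmonic0 : harmonic_number R 0 = 0.
Proof. by rewrite /harmonic_number big_geq. Qed.

Lemma alt_cauchy0 n : alt_cauchy n 0 = - harmonic_number R n.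
Proof.
elim: n => [|n IH].
  by rewrite /alt_cauchy harmonic0 big_ord1 subrr invr0 mulr0 oppr0.
by rewrite alt_cauchyS IH sub0r alt_cauchyN1 harmonicS opprD.
Qed.

(** Induction on [n] by Pascal's rule. The end columns need separate arguments,
    since the rule for [n + 1] calls on the columns [-1] and [n + 1] of row [n]:
    column [0] is [alt_cauchy0], and [k = n] follows from it by reflection. *)
Lemma alt_cauchy_nat n k : (k <= n)%N ->
  alt_cauchy n k%:R
  = altbin n k * (harmonic_number R k - harmonic_number R (n - k)).
Proof.
elim: n k => [|n IH] k.
  by rewrite leqn0 => /eqP ->; rewrite alt_cauchy0 harmonic0 subrr oppr0 mulr0.
case: k => [_|k].
  by rewrite alt_cauchy0 /altbin bin0 expr0 !mul1r harmonic0 sub0r subn0.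
rewrite ltnS leq_eqVlt => /predU1P[->|kn].
  rewrite subnn -[X in alt_cauchy _ X]subr0 alt_cauchy_refl alt_cauchy0.
  by rewrite mulrN opprK /altbin binn mulr1 harmonic0 subr0.
rewrite alt_cauchyS IH // -natr1 addrK IH; last exact: ltnW.
have -> : (n - k = (n - k.+1).+1)%N by lia.
have -> : (n.+1 - k.+1 = (n - k.+1).+1)%N by lia.
rewrite !harmonicS /altbin binS natrD exprS.
have e : 'C(n, k.+1)%:R * k.+1%:R = 'C(n, k)%:R * (n - k.+1).+1%:R :> R.
  have := mul_bin_left n k; have -> : (n - k = (n - k.+1).+1)%N by lia.
  by move=> h; rewrite -!natrM mulnC h mulnC.
have u1 : k.+1%:R != 0 :> R by rewrite pnatr_eq0.
have u2 : (n - k.+1).+1%:R != 0 :> R by rewrite pnatr_eq0.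
move: e u1 u2; set a := k.+1%:R; set b := (n - k.+1).+1%:R.
move: 'C(n, k.+1)%:R 'C(n, k)%:R => p q e a0 b0.
have -> : p = q * b / a by rewrite -e mulfK.
clearbody a b; field; by rewrite a0 b0.
Qed.

(** The residue at [t = - k] of the square of [\sum_k altbin n k / (t + k)]. *)
Definition residue n k : R := 2 * altbin n k * alt_cauchy n k%:R.

Lemma residueE n k : (k <= n)%N ->
  residue n k = 2 * 'C(n, k)%:R ^+ 2
                * (harmonic_number R k - harmonic_number R (n - k)).
Proof.
by move=> kn; rewrite /residue alt_cauchy_nat // -sqr_altbin; ring.
Qed.

Lemma residue_sub n k : (k <= n)%N -> residue n (n - k) = - residue n k.
Proof.
move=> kn; rewrite !residueE ?leq_subr // subKn // bin_sub //; ring.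
Qed.

(** Exchanging [k] and [l] in the double sum changes the sign of [l - k];
    averaging both forms gives divided differences of [f]. The choices
    [f = 1], [f = id] and [f = fun x => (t + x)^-1] yield the three facts on
    residues used below. *)
Lemma sum_mul_residue n (f : R -> R) :
  \sum_(k < n.+1) f k%:R * residue n k =
  \sum_(k < n.+1) \sum_(l < n.+1)
     altbin n k * altbin n l * ((f k%:R - f l%:R) / (l%:R - k%:R)).
Proof.
transitivity (\sum_(k < n.+1) \sum_(l < n.+1)
     altbin n k * altbin n l * (f k%:R / (l%:R - k%:R)) *+ 2).
  apply: eq_bigr => k _; rewrite /residue /alt_cauchy !mulr_sumr.
  by apply: eq_bigr => l _; ring.
under eq_bigr do rewrite sumrMnl; rewrite sumrMnl mulr2n.
rewrite [X in _ + X]exchange_big /= -big_split /=.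
apply: eq_bigr => k _; rewrite -big_split /=; apply: eq_bigr => l _.
rewrite -[k%:R - l%:R]opprB invrN; ring.
Qed.

Lemma sum_residue n : \sum_(k < n.+1) residue n k = 0.
Proof.
have := sum_mul_residue n (fun=> 1).
under eq_bigr do rewrite mul1r; move=> ->.
by apply: big1 => k _; apply: big1 => l _; rewrite subrr mul0r mulr0.
Qed.

Lemma sum_natM_residue n : (0 < n)%N ->
  \sum_(k < n.+1) k%:R * residue n k = 'C(2 * n, n)%:R.
Proof.
move=> n0; rewrite (sum_mul_residue n id) -sum_altbin_sqr.
apply: eq_bigr => k _.
(* The divided difference of the identity is [-1] off the diagonal, so the sum
   over [l != k] is that over all [l], which is [0], up to the diagonal term. *)
rewrite [RHS](_ : _ = altbin n k ^+ 2 - altbin n k * \sum_(l < n.+1) altbin n l);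
  last by rewrite sum_altbin // mulr0 subr0.
rewrite (bigD1 k) //= [in RHS](bigD1 k) //= subrr mul0r mulr0 add0r mulrDr opprD.
rewrite addrA -expr2 subrr sub0r mulr_sumr -sumrN; apply: eq_bigr => l lk.
rewrite -[k%:R - l%:R]opprB mulNr divff ?mulrN1 //.
by rewrite subr_eq0 eqr_nat.
Qed.

Lemma sqr_partial_fraction n t : 0 < t ->
  (\sum_(k < n.+1) altbin n k / (t + k%:R)) ^+ 2 =
  \sum_(k < n.+1) ('C(n, k)%:R ^+ 2 / (t + k%:R) ^+ 2 + residue n k / (t + k%:R)).
Proof.
move=> t0; have tk (k : nat) : t + k%:R != 0 by rewrite gt_eqF // ltr_pwDl.
rewrite big_split /=.
under [X in _ = _ + X]eq_bigr do rewrite mulrC.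
rewrite (sum_mul_residue n (fun x => (t + x)^-1)) expr2 big_distrlr /=.
rewrite -big_split /=; apply: eq_bigr => k _.
rewrite (bigD1 k) //= [in RHS](bigD1 k) //= subrr mul0r mulr0 add0r.
congr (_ + _); first by rewrite -sqr_altbin; field.
apply: eq_bigr => l lk.
have lk0 : l%:R - k%:R != 0 :> R by rewrite subr_eq0 eqr_nat.
by field; rewrite lk0 !tk.
Qed.

End PartialFraction.

(** * Integrality of the harmonic form *)

Lemma dvdn_lcm_upto m k : (0 < k <= m)%N -> (k %| lcm_upto m)%N.
Proof.
elim: m => [|m IH]; first by case: k.
rewrite /lcm_upto big_nat_recr //= => /andP[k0].
rewrite leq_eqVlt ltnS => /predU1P[->|km]; first exact: dvdn_lcmr.
by apply: (dvdn_trans (IH _)); [rewrite k0|exact: dvdn_lcml].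
Qed.

Lemma lcm_upto_harmonic_int (R : realType) m k : (k <= m)%N ->
  (lcm_upto m)%:R * harmonic_number R k \is a Num.int.
Proof.
move=> km; rewrite /harmonic_number big_nat mulr_sumr rpred_sum // => i /andP[i0 ik].
have /dvdnP[q ->] : (i %| lcm_upto m)%N by apply: dvdn_lcm_upto; lia.
by rewrite natrM mulfK ?pnatr_eq0 -?lt0n // natr_int.
Qed.

Lemma harmonic_form_int (R : realType) n :
  (lcm_upto (2 * n))%:R * harmonic_form R n \is a Num.int.
Proof.
rewrite /harmonic_form big_nat mulr_sumr rpred_sum // => i /andP[_ ik].
rewrite mulrCA rpredM ?rpredX ?natr_int // lcm_upto_harmonic_int //; lia.
Qed.

(** * The linear form in logarithms *)

Section EulerLimit.
Variable R : realType.

Lemma harmonic_number_sub (i j : nat) : (i <= j)%N ->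
  \sum_(i.+1 <= m < j.+1) m%:R^-1 = harmonic_number R j - harmonic_number R i.
Proof.
by move=> ij; rewrite /harmonic_number (@big_cat_nat _ _ _ i.+1 1%N j.+1) //=
   addrAC subrr add0r.
Qed.

Lemma sum_residue_prefix n k : (k <= n.+1)%N ->
  \sum_(k <= i < n.+1) residue R n i = - \sum_(0 <= i < k) residue R n i.
Proof.
move=> kn; apply/eqP; rewrite -addr_eq0 addrC -big_cat_nat //.
by rewrite big_mkord sum_residue.
Qed.

(** The residues are antisymmetric under [i |-> n - i], so the middle block of
    indices, between [k] and [n + 1 - k], contributes [0]. This is what allows
    [log_form] to stop at [minn k.-1 (n - k)] rather than at [k - 1]. *)
Lemma sum_residue_refl n k : (k <= n.+1)%N ->
  \sum_(0 <= i < n.+1 - k) residue R n i = \sum_(0 <= i < k) residue R n i.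
Proof.
move=> kn; apply: oppr_inj; rewrite -[RHS]sum_residue_prefix // -sumrN.
rewrite -{2}[k]add0n big_addn [RHS]big_nat_rev /= !big_nat.
apply: eq_bigr => i /andP[_ ik].
rewrite -residue_sub; last by lia.
by congr residue; lia.
Qed.

(** By [residueE] the innermost sum of [log_form] is [- residue R n i], so the
    coefficient of [ln (n + k)] is the sum of the residues of index at least [k];
    exchanging the two sums gives the form in which [log_form] arises by
    telescoping. *)
Lemma log_form_residue n :
  log_form R n =
  \sum_(0 <= k < n.+1) residue R n k * \sum_(1 <= q < k.+1) ln (n + q)%:R.
Proof.
transitivity (\sum_(1 <= k < n.+1) \sum_(0 <= i < n.+1 | (k <= i)%N)
                residue R n i * ln (n + k)%:R).
  rewrite /log_form !big_nat; apply: eq_bigr => k /andP[k0 kn].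
  rewrite -(big_nat_widenl k 0 n.+1 xpredT) // -mulr_suml.
  rewrite sum_residue_prefix; last by lia.
  rewrite (_ : \sum_(0 <= i < k) _ =
    \sum_(0 <= i < (minn k.-1 (n - k)).+1) residue R n i); last first.
    case: (leqP k.-1 (n - k)) => h; first by rewrite prednK.
    by rewrite -subSn // sum_residue_refl // ltnW.
  rewrite -sumrN mulr_suml !big_nat; apply: eq_bigr => i /andP[_ im].
  rewrite -mulr_suml -mulr_sumr -mulr_sumr harmonic_number_sub; last by lia.
  by rewrite residueE; [ring|lia].
rewrite (exchange_big_dep_nat xpredT) //=.
rewrite !big_nat; apply: eq_bigr => i /andP[_ ik].
rewrite mulr_sumr [RHS](big_nat_widen _ _ n.+1) //.
Qed.

(** * Summing the tail integrals *)

(** The value of [\int_v^oo (\sum_k altbin R n k / (t + 1 + k))^2 dt]. *)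
Definition tail_int n (v : nat) : R :=
  \sum_(k < n.+1) ('C(n, k)%:R ^+ 2 / (v.+1 + k)%:R
                   - residue R n k * ln (v.+1 + k)%:R).

Definition sum_ln (M k : nat) : R := \sum_(1 <= q < k.+1) ln (M + q)%:R.

Lemma sum_shift_harmonic (n N k : nat) :
  \sum_(0 <= j < N) ((n + j).+1 + k)%:R^-1
  = harmonic_number R (n + N + k) - harmonic_number R (n + k).
Proof.
rewrite -harmonic_number_sub; last by lia.
rewrite -[(n + k).+1]add0n big_addn (_ : _ - _ = N)%N; last by lia.
by apply: eq_bigr => i _; congr (_%:R^-1); lia.
Qed.

(** Shifting the window of summation by [k] only changes its two ends. *)
Lemma sum_shift_ln (n N k : nat) :
  \sum_(0 <= j < N) ln ((n + j).+1 + k)%:R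
  = \sum_(0 <= j < N) ln (n + j).+1%:R + sum_ln (n + N) k - sum_ln n k.
Proof.
elim: N => [|N IH]; first by rewrite !big_geq // add0r addn0 subrr.
rewrite !big_nat_recr //= {}IH.
rewrite [X in X + _ = _](_ : _ = \sum_(0 <= j < N) ln (n + j).+1%:R - sum_ln n k
                            + sum_ln (n + N) k); last by ring.
rewrite [RHS](_ : _ = \sum_(0 <= j < N) ln (n + j).+1%:R - sum_ln n k
                + (ln (n + N).+1%:R + sum_ln (n + N.+1) k)); last by ring.
rewrite -addrA; congr (_ + _); rewrite /sum_ln.
transitivity (\sum_(1 <= q < k.+2) ln (n + N + q)%:R : R).
  by rewrite [RHS]big_nat_recr //= addSnnS.
rewrite big_nat_recl // addn1; congr (_ + _).
by apply: eq_bigr => i _; congr (ln _%:R); lia.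
Qed.

(** Every summand on the right is written so that it converges as [M] grows: the
    multiples of [ln M] that are inserted add up to [0] by [sum_natM_residue]. *)
Lemma sum_tail_int n N : (0 < n)%N -> let M := (n + N)%N in
  \sum_(0 <= j < N) tail_int n (n + j) =
  \sum_(k < n.+1) ('C(n, k)%:R ^+ 2 *
       ((harmonic_number R (M + k) - ln (M + k)%:R) + (ln (M + k)%:R - ln M%:R))
     - residue R n k * \sum_(1 <= q < k.+1) (ln (M + q)%:R - ln M%:R))
  + log_form R n - harmonic_form R n.
Proof.
move=> n0 M; rewrite log_form_residue /harmonic_form !big_mkord.
transitivity (\sum_(k < n.+1) ('C(n, k)%:R ^+ 2 *
     (harmonic_number R (M + k) - harmonic_number R (n + k))
     - residue R n k * (\sum_(0 <= j < N) ln (n + j).+1%:R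
                        + sum_ln (n + N) k - sum_ln n k))).
  rewrite exchange_big /=; apply: eq_bigr => k _.
  rewrite sumrB -!mulr_sumr; congr (_ * _ - _ * _).
    by rewrite -sum_shift_harmonic big_mkord.
  by rewrite -sum_shift_ln big_mkord.
rewrite -big_split -sumrB /=.
(* The first part of [D] is the sum of the logarithms common to all [k], which
   [sum_residue] kills; the second collects the inserted multiples of [ln M]. *)
pose D := \sum_(k < n.+1) (residue R n k * - \sum_(0 <= j < N) ln (n + j).+1%:R
   + ('C(n, k)%:R ^+ 2 * ln M%:R - k%:R * residue R n k * ln M%:R)).
have D0 : D = 0.
  rewrite /D big_split sumrB /= -!mulr_suml sum_residue mul0r add0r.
  rewrite sum_natM_residue // -sum_altbin_sqr.
  by under eq_bigr do rewrite -sqr_altbin; rewrite subrr.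
rewrite -[RHS]addr0 -[X in _ = _ + X]D0 -big_split /=; apply: eq_bigr => k _.
rewrite sumrB -/(sum_ln M k) sumr_const_nat subn1 /= -/(sum_ln n k).
rewrite -[_ *+ nat_of_ord k]mulr_natl /M.
ring.
Qed.

Lemma ln_nat_step (N : nat) : (0 < N)%N ->
  N.+1%:R^-1 <= ln N.+1%:R - ln (N%:R : R) <= N%:R^-1.
Proof.
move=> N0; have N0' : 0 < N%:R :> R by rewrite ltr0n.
have N1 : 0 < N.+1%:R :> R by rewrite ltr0n.
rewrite -ln_div ?posrE //; apply/andP; split.
  rewrite -lerN2 -lnV ?posrE ?divr_gt0 // invf_div.
  have -> : N%:R / N.+1%:R = 1 + (- N.+1%:R^-1) :> R.
    by rewrite -natr1 in N1 *; field; rewrite gt_eqF.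
  apply: le_ln1Dx; rewrite ltrN2 invf_lt1 // ltr1n; lia.
have -> : N.+1%:R / N%:R = 1 + N%:R^-1 :> R.
  by rewrite -natr1; field; rewrite gt_eqF.
by apply: le_ln1Dx; rewrite (lt_trans (ltrN10 _)) // invr_gt0.
Qed.

(** The sequence decreases and is bounded below by [0] from [N = 1] on; the value
    at [N = 0], where [ln 0 = 0], breaks monotonicity and is shifted away. *)
Lemma cvg_euler_gamma :
  (fun N : nat => harmonic_number R N - ln (N%:R : R)) @ \oo --> euler_gamma R.
Proof.
set u := fun N : nat => _.
suff [l ul] : exists l : R, u @ \oo --> l.
  by rewrite /euler_gamma -/u (cvg_lim _ ul).
pose v := [sequence u (k + 1)%N]_k.
have vcvg : cvgn v.
  apply: nonincreasing_is_cvgn.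
    apply/nonincreasing_seqP => N; rewrite /v /= /u !addn1 harmonicS.
    have /andP[+ _] := ln_nat_step (ltn0Sn N).
    move: (N.+2%:R^-1 : R) (ln _ : R) (ln _ : R) => a b c; lra.
  exists 0 => _ [N _ <-]; rewrite /v /= /u addn1.
  have h : ln N.+1%:R <= harmonic_number R N.
    elim: N => [|N IH]; first by rewrite ln1 harmonic0.
    rewrite harmonicS -lerBlDl; have /andP[_] := ln_nat_step (ltn0Sn N).
    by apply: le_trans; rewrite lerD2l lerN2.
  by rewrite subr_ge0 harmonicS (le_trans h) // lerDl invr_ge0.
by exists (lim (v @ \oo)); rewrite -(cvg_shiftn 1).
Qed.

Lemma cvg_ln_shift (q : nat) :
  (fun N : nat => ln (N + q)%:R - ln N%:R : R) @ \oo --> (0 : R).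
Proof.
elim: q => [|q IH].
  by under eq_fun do rewrite addn0 subrr; exact: cvg_cst.
rewrite (_ : (fun N => _) = (fun N : nat => (ln (N + q.+1)%:R - ln (N + q)%:R)
                            + (ln (N + q)%:R - ln N%:R : R))); last first.
  by apply/funext => N; rewrite subrKA.
rewrite -[X in _ --> X]addr0; apply: cvgD => //.
apply: (@squeeze_cvgr _ _ _ _ (fun=> 0) (fun N : nat => N%:R^-1)).
- near=> N; have N0 : (0 < N)%N by near: N; exists 1%N.
  rewrite addnS; have Nq : (0 < N + q)%N by lia.
  have /andP[h1 h2] := ln_nat_step Nq; apply/andP; split.
    by apply: le_trans h1; rewrite invr_ge0.
  apply: (le_trans h2); rewrite lef_pV2 ?posrE ?ltr0n // ler_nat; lia.
- exact: cvg_cst.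
- apply/gtr0_cvgV0; last exact: cvgr_idn.
  by near=> N; rewrite ltr0n; near: N; exists 1%N.
Unshelve. all: end_near.
Qed.

Lemma cvg_sum (I : Type) (r : seq I) (f : I -> nat -> R) (l : I -> R) :
  (forall i, f i @ \oo --> l i) ->
  (fun N => \sum_(i <- r) f i N) @ \oo --> \sum_(i <- r) l i.
Proof. by move=> h; apply: cvg_big => //; exact: add_continuous. Qed.

Lemma cvg_sum_tail_int n : (0 < n)%N ->
  (fun N => \sum_(0 <= j < N) tail_int n (n + j)) @ \oo -->
  'C(2 * n, n)%:R * euler_gamma R + log_form R n - harmonic_form R n.
Proof.
move=> n0; under eq_fun do rewrite sum_tail_int //.
have sh (f : nat -> R) (k : nat) (l : R) :
  f @ \oo --> l -> (fun N => f (n + N + k)%N) @ \oo --> l.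
  move=> fl; under eq_fun do rewrite addnAC addnC.
  by rewrite -(cvg_shiftn (n + k)) in fl.
apply: cvgB; last exact: cvg_cst.
apply: cvgD; last exact: cvg_cst.
have -> : 'C(2 * n, n)%:R * euler_gamma R =
  \sum_(k < n.+1) ('C(n, k)%:R ^+ 2 * (euler_gamma R + 0)
                   - residue R n k * \sum_(1 <= q < k.+1) 0).
  rewrite -sum_altbin_sqr mulr_suml; apply: eq_bigr => k _.
  by rewrite sqr_altbin big1_eq mulr0 subr0 addr0.
have lnsh q : (fun N => ln (n + N + q)%:R - ln (n + N)%:R : R) @ \oo --> (0 : R).
  have := sh _ 0%N _ (cvg_ln_shift q).
  by under eq_fun do rewrite addn0.
apply: cvg_sum => k.
apply: cvgB; apply: cvgMl_tmp.
  apply: cvgD; last exact: lnsh.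
  exact: (sh _ k _ cvg_euler_gamma).
by apply: cvg_sum => q; exact: lnsh.
Qed.
End EulerLimit.

(** * Measurability and exchange of integrals *)

Section Tonelli.
Variable R : realType.
Local Notation mu := (@lebesgue_measure R).

(** [x^-1 = x * (x^2)^-1] holds at [0] too, and on nonnegative reals inversion is
    the power function of exponent [-1], which is known to be measurable. *)
Lemma measurable_funV d (T : measurableType d) (D : set T) (f : T -> R) :
  measurable_fun D f -> measurable_fun D (fun x => (f x)^-1).
Proof.
move=> mf.
rewrite (_ : (fun x => _) = (fun x => f x * (f x ^+ 2) `^ (-1))); last first.
  apply/funext => x; rewrite powR_inv1 ?sqr_ge0 // expr2.
  have [->|fx0] := eqVneq (f x) 0; first by rewrite mul0r invr0.
  by rewrite invfM mulrA divff // mul1r.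
apply: measurable_funM => //.
apply: (measurableT_comp (measurable_powR (-1))).
exact: measurable_funX.
Qed.

Lemma measurable_powR_pair :
  measurable_fun [set: R * R] (fun z : R * R => z.1 `^ z.2).
Proof.
rewrite /powR; apply: measurable_fun_ifT => /=.
- by apply: measurable_fun_eqr => //; exact: measurable_fst.
- rewrite (_ : (fun t : R * R => _) =
    (fun t : R * R => if t.2 == 0 then 1 else 0)); last first.
    by apply/funext => t; case: ifP.
  apply: measurable_fun_ifT => //=.
  by apply: measurable_fun_eqr => //; exact: measurable_snd.
- apply: measurableT_comp => //; apply: measurable_funM => //.
  by apply: measurableT_comp => //; exact: measurable_ln.
Qed.

(** Tonelli's theorem on a rectangle [A * B], where [f] is only known to be
    nonnegative on the rectangle: [f] is multiplied by the two indicators. *)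
Section swap.
Variables (A B : set R) (f : R -> R -> R).
Hypotheses (mA : measurable A) (mB : measurable B).
Hypothesis mf : measurable_fun [set: R * R] (fun z : R * R => f z.1 z.2).
Hypothesis f0 : forall x y, A x -> B y -> 0 <= f x y.

Let g (z : R * R) : \bar R := (f z.1 z.2 * \1_A z.1 * \1_B z.2)%:E.

Let mg : measurable_fun [set: R * R] g.
Proof.
apply/measurable_EFinP; apply: measurable_funM; first apply: measurable_funM => //.
  by apply: measurableT_comp => //; exact: measurable_indic.
by apply: measurableT_comp => //; exact: measurable_indic.
Qed.

Let g0 z : (0 <= g z)%E.
Proof.
rewrite /g lee_fin !indicE.
case: (asboolP (A z.1)) => [Az|nAz]; last by rewrite memNset // mulr0 mul0r.
case: (asboolP (B z.2)) => [Bz|nBz]; last by rewrite [_ \in B]memNset // mulr0.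
by rewrite !mem_set // !mulr1 f0.
Qed.

Let gF x : A x -> (\int[mu]_y g (x, y) = \int[mu]_(y in B) (f x y)%:E)%E.
Proof.
move=> Ax; rewrite [RHS]integral_mkcond; apply: eq_integral => y _.
by rewrite /g /patch !indicE /= mem_set // mulr1; case: ifP; rewrite ?mulr1 ?mulr0.
Qed.

Let gG y : B y -> (\int[mu]_x g (x, y) = \int[mu]_(x in A) (f x y)%:E)%E.
Proof.
move=> By; rewrite [RHS]integral_mkcond; apply: eq_integral => x _.
rewrite /g /patch !indicE /= [y \in B]mem_set // mulr1.
by case: ifP; rewrite ?mulr1 ?mulr0.
Qed.

Lemma measurable_integral_section :
  measurable_fun A (fun x => \int[mu]_(y in B) (f x y)%:E)%E.
Proof.
have h := @measurable_fun_fubini_tonelli_F _ _ _ _ _ mu g mg g0.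
apply: (eq_measurable_fun _ _ (measurable_funTS h)) => x; rewrite inE => Ax.
by rewrite /fubini_F gF.
Qed.

Lemma integral_swap :
  (\int[mu]_(x in A) \int[mu]_(y in B) (f x y)%:E
   = \int[mu]_(y in B) \int[mu]_(x in A) (f x y)%:E)%E.
Proof.
transitivity (\int[mu]_x \int[mu]_y g (x, y))%E.
  rewrite integral_mkcond; apply: eq_integral => x _; rewrite /patch.
  case: ifPn => [/set_mem Ax|xA]; first by rewrite gF.
  by rewrite integral0_eq // => y _; rewrite /g indicE (negbTE xA) mulr0 mul0r.
rewrite (@fubini_tonelli _ _ _ _ _ mu mu g mg g0) [RHS]integral_mkcond.
apply: eq_integral => y _; rewrite /patch.
case: ifPn => [/set_mem By|yB]; first by rewrite gG.
by rewrite integral0_eq // => x _; rewrite /g [\1_B _]indicE (negbTE yB) mulr0.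
Qed.

End swap.
End Tonelli.

(** * Integrals from antiderivatives *)

Section Antiderivative.
Variable R : realType.
Local Notation mu := (@lebesgue_measure R).
Implicit Types (n k : nat) (x t u : R).

Lemma is_derive_continuous (f : R -> R) x (df : R) :
  is_derive x (1 : R) f df -> {for x, continuous f}.
Proof. by move=> [df1 _]; apply/differentiable_continuous/derivable1_diffP. Qed.

Lemma is_derive_sum_fun n (f : 'I_n -> R -> R) (df : 'I_n -> R) x :
  (forall i, is_derive x (1 : R) (f i) (df i)) ->
  is_derive x (1 : R) (fun y => \sum_(i < n) f i y) (\sum_(i < n) df i).
Proof.
move=> h; have := is_derive_sum h.
by congr is_derive; apply/funext => y; rewrite fct_sumE.
Qed.

(** The fundamental theorem on a half line, with derivative and continuity also
    assumed at the endpoint [a], which spares one-sided limits. *)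
Lemma integral_itvcy_derive (f F : R -> R) (a l : R) :
  (forall x, a <= x -> is_derive x (1 : R) F (f x)) ->
  (forall x, a <= x -> {for x, continuous f}) ->
  (forall x, a <= x -> 0 <= f x) ->
  F x @[x --> +oo] --> l ->
  (\int[mu]_(x in `[a, +oo[) (f x)%:E = (l - F a)%:E)%E.
Proof.
move=> dF cf f0 Fl; rewrite (@ge0_continuous_FTC2y _ f F a l) ?EFinB //.
- apply: continuous_in_subspaceT => x; rewrite inE /= in_itv /= andbT => ax.
  exact: cf.
- by move=> x ax; have [] := dF _ (ltW ax).
- apply: cvg_at_right_filter; exact: (is_derive_continuous (dF _ (lexx a))).
- move=> x; rewrite in_itv /= andbT => ax; rewrite derive1E.
  by have [_ ->] := dF _ (ltW ax).
Qed.

Lemma integral_expR_lt0 (b a : R) : b < 0 ->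
  (\int[mu]_(t in `[a, +oo[) (expR (t * b))%:E = (- (expR (a * b) / b))%:E)%E.
Proof.
move=> b0; have dF x : is_derive x (1 : R) (fun t : R => expR (t * b)) (b * expR (x * b)).
  have h : is_derive x (1 : R) (fun t => t * b) b.
    by apply: is_derive_eq; rewrite /= scaler0 add0r scaler1.
  have := @is_derive1_comp _ expR (fun t => t * b) x _ _ (is_derive_expR (x * b)) h.
  by rewrite mulrC.
have F0 : expR (t * b) / b @[t --> +oo] --> (0 : R).
  rewrite -[X in _ --> X](mul0r b^-1); apply: cvgMr_tmp.
  rewrite (_ : (fun t => _) = (fun t => expR (- t)) \o (fun t => t * - b)).
    apply: cvg_comp; last exact: cvgr_expR.
    by apply: gt0_cvgMly => //; rewrite oppr_gt0.
  by apply/funext => t /=; rewrite mulrN opprK.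
have dFb x : is_derive x (1 : R) (fun t => expR (t * b) / b) (expR (x * b)).
  have h := @is_deriveM _ _ _ (cst b^-1) x 1 _ _ (dF x) (is_derive_cst _ _ _).
  apply: (is_derive_eq h); rewrite scaler0 add0r /cst /= -[_ *: _]/(_ * _).
  by rewrite mulKf // lt_eqF.
rewrite -sub0r; apply: (integral_itvcy_derive _ _ _ F0) => x _.
- exact: is_derive_continuous (dF x).
- exact: expR_ge0.
Qed.

Definition beta_kernel n t x : R := x `^ t * (1 - x) ^+ n.

Definition beta_sum n t : R := \sum_(k < n.+1) altbin R n k / (t + 1 + k%:R).

(** Expanding [(1 - x)^n] gives the antiderivative
    [\sum_k altbin R n k / (t + 1 + k) * x^(t + 1 + k)]. The integral is a value
    of Euler's beta function; this sum, rather than the product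
    [n! / ((t + 1) (t + 2) ... (t + n + 1))], is the form whose square splits into
    partial fractions. *)
Lemma integral_beta_kernel n t : 0 < t ->
  (\int[mu]_(x in `[0%R, 1%R]) (beta_kernel n t x)%:E = (beta_sum n t)%:E)%E.
Proof.
rewrite /beta_kernel /beta_sum => t0.
have p (k : nat) : 0 < t + 1 + k%:R by rewrite ltr_pwDl // addr_gt0.
pose F x := \sum_(k < n.+1) altbin R n k / (t + 1 + k%:R) * x `^ (t + 1 + k%:R).
have dF x : 0 < x -> is_derive x (1 : R) F (x `^ t * (1 - x) ^+ n).
  move=> x0; have h (k : 'I_n.+1) :=
    is_deriveZ (altbin R n k / (t + 1 + k%:R)) (is_derive1_powR (t + 1 + k%:R) x0).
  apply: (is_derive_eq (is_derive_sum_fun h)).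
  rewrite exprBn mulr_sumr; apply: eq_bigr => k _.
  rewrite expr1n mulr1 -[_ *: _]/(_ * _) mulrA divfK ?gt_eqF //.
  have -> : x `^ (t + 1 + k%:R - 1) = x `^ t * x ^+ k.
    rewrite (_ : _ - 1 = t + k%:R); last by ring.
    by rewrite powRD ?(gt_eqF x0) ?implybT // powR_mulrn // ltW.
  by rewrite /altbin -mulr_natr; ring.
have F0 : F 0 = 0.
  by rewrite /F big1 // => k _; rewrite powR0 ?mulr0 // gt_eqF.
have cpow x : {for x, continuous (fun x => (1 - x) ^+ n)}.
  apply: (@continuous_comp _ _ _ (fun x => 1 - x) (fun y => y ^+ n)).
    by apply: continuousB; [exact: cst_continuous|exact: cvg_id].
  exact: exprn_continuous.
rewrite (@continuous_FTC2 _ _ F) // ?F0 ?sube0.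
- by rewrite /F; congr EFin; apply: eq_bigr => k _; rewrite powR1 mulr1.
- apply/continuous_within_itvP => //; split.
  + move=> x; rewrite in_itv /= => /andP[x0 _]; apply: cvgM; last exact: cpow.
    exact: is_derive_continuous (is_derive1_powR t x0).
  + rewrite powR0 ?gt_eqF //; apply: cvgM; first exact: powR_cvg0.
    exact/cvg_at_right_filter/cpow.
  + apply: cvg_at_left_filter; apply: cvgM; last exact: cpow.
    exact: is_derive_continuous (is_derive1_powR t ltr01).
- split.
  + by move=> x; rewrite in_itv /= => /andP[x0 _]; have [] := dF _ x0.
  + rewrite F0 [X in _ --> X](_ : 0 = \sum_(k < n.+1) altbin R n k / (t + 1 + k%:R) * 0).
      apply: cvg_big; first exact: add_continuous.
      by move=> k _; apply: cvgMl_tmp; exact: powR_cvg0.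
    by rewrite big1 // => k _; rewrite mulr0.
  + by apply: cvg_at_left_filter; exact: is_derive_continuous (dF _ ltr01).
- move=> x; rewrite in_itv /= => /andP[x0 _]; rewrite derive1E.
  by have [_ ->] := dF _ x0.
Qed.

End Antiderivative.

(** * The tail integrals *)

Section TailIntegral.
Variable R : realType.
Local Notation mu := (@lebesgue_measure R).
Implicit Types (n k v : nat) (x t u c : R).

Lemma is_derive_addr c t : is_derive t (1 : R) (fun s => s + c) 1.
Proof.
by apply: (is_derive_eq (is_deriveD (is_derive_id _ _) (is_derive_cst c _ _)));
   rewrite addr0.
Qed.

Lemma is_derive_inv_addr c t : t + c != 0 ->
  is_derive t (1 : R) (fun s => (s + c)^-1) (- (t + c) ^- 2).
Proof.
move=> tc.
have h := @is_deriveV _ (fun s => s + c) t _ _ tc (is_derive_addr c t).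
apply: (is_derive_eq h).
by rewrite scaler1.
Qed.

Lemma is_derive_ln_addr c t : 0 < t + c ->
  is_derive t (1 : R) (fun s => ln (s + c)) (t + c)^-1.
Proof.
move=> tc.
have h := @is_derive1_comp _ (@ln R) (fun s => s + c) t _ _ (is_derive1_ln tc)
            (is_derive_addr c t).
apply: (is_derive_eq h).
by rewrite mulr1.
Qed.

Lemma cvg_inv_addr c : (t + c)^-1 @[t --> +oo] --> (0 : R).
Proof.
have h : t + c @[t --> +oo] --> +oo.
  apply/cvgryPge => A; near=> t; rewrite -lerBlDr.
  by near: t; apply: nbhs_pinfty_ge; exact: num_real.
apply/gtr0_cvgV0 => //.
by near=> t; rewrite -ltrBlDr sub0r; near: t; apply: nbhs_pinfty_gt; exact: num_real.
Unshelve. all: end_near.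
Qed.

Lemma cvg_ln_addr c : 0 <= c -> ln (t + c) - ln t @[t --> +oo] --> (0 : R).
Proof.
move=> c0; apply: (@squeeze_cvgr _ _ _ _ (fun=> 0) (fun t => c * (t + 0)^-1)).
- near=> t; have t0 : 0 < t by near: t; apply: nbhs_pinfty_gt; exact: num_real.
  rewrite addr0 subr_ge0 ler_ln ?posrE ?ltr_pwDl // lerDl c0 /=.
  rewrite -ln_div ?posrE ?ltr_pwDl // mulrDl divff ?gt_eqF //.
  by apply: le_ln1Dx; rewrite (lt_le_trans (ltrN10 _)) // divr_ge0 // ltW.
- exact: cvg_cst.
- by rewrite -[X in _ --> X](mulr0 c); apply: cvgMl_tmp; exact: cvg_inv_addr.
Unshelve. all: end_near.
Qed.

(** Integrates the partial fraction expansion of the square termwise. The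
    antiderivative [F] tends to [0] at infinity, so that the integral is
    [- F v%:R]. *)
Lemma integral_beta_sum_sqr n v :
  (\int[mu]_(t in `[v%:R, +oo[) (beta_sum n t ^+ 2)%:E = (tail_int R n v)%:E)%E.
Proof.
have p t k : v%:R <= t -> 0 < t + (1 + k%:R).
  by move=> vt; rewrite addrCA ltr_pwDl // addr_ge0 // (le_trans _ vt).
have beta_sumE t : beta_sum n t = \sum_(k < n.+1) altbin R n k * (t + (1 + k%:R))^-1.
  by apply: eq_bigr => k _; rewrite addrA.
pose F t : R := \sum_(k < n.+1) (- 'C(n, k)%:R ^+ 2 * (t + (1 + k%:R))^-1
                                 + residue R n k * ln (t + (1 + k%:R))).
have dF t : v%:R <= t -> is_derive t (1 : R) F (beta_sum n t ^+ 2).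
  move=> vt; have h (k : 'I_n.+1) := is_deriveD
    (is_deriveZ (- 'C(n, k)%:R ^+ 2) (is_derive_inv_addr (lt0r_neq0 (p t k vt))))
    (is_deriveZ (residue R n k) (is_derive_ln_addr (p t k vt))).
  apply: (is_derive_eq (is_derive_sum_fun h)).
  rewrite /beta_sum sqr_partial_fraction; last by have := p t 0%N vt; rewrite addr0.
  apply: eq_bigr => k _; rewrite -addrA -[_ *: _]/(_ * _); congr (_ + _).
  by rewrite mulrNN.
have cf t : v%:R <= t -> {for t, continuous (fun t => beta_sum n t ^+ 2)}.
  move=> vt; apply: (@continuous_comp _ _ _ (beta_sum n) (fun y => y ^+ 2)).
    rewrite (_ : beta_sum n = fun t => \sum_(k < n.+1) altbin R n k * (t + (1 + k%:R))^-1);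
      last by apply/funext => s; exact: beta_sumE.
    suff : \sum_(k < n.+1) altbin R n k * (s + (1 + k%:R))^-1 @[s --> t] -->
           \sum_(k < n.+1) altbin R n k * (t + (1 + k%:R))^-1 by [].
    apply: cvg_big; first exact: add_continuous.
    move=> k _; apply: cvgMl_tmp.
    exact: is_derive_continuous (is_derive_inv_addr (lt0r_neq0 (p t k vt))).
  exact: exprn_continuous.
(* The divergent [ln t] can be subtracted from each logarithm of [F] at no cost,
   the residues having sum [0]. *)
have Foo : F t @[t --> +oo] --> (0 : R).
  rewrite (_ : F = fun t => \sum_(k < n.+1) (- 'C(n, k)%:R ^+ 2 * (t + (1 + k%:R))^-1
                   + residue R n k * (ln (t + (1 + k%:R)) - ln t))); last first.
    apply/funext => t; apply/eqP; rewrite -subr_eq0 -sumrB.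
    rewrite (eq_bigr (fun k : 'I_n.+1 => residue R n k * ln t)).
      by rewrite -mulr_suml sum_residue mul0r.
    by move=> k _; ring.
  rewrite [X in _ --> X](_ : 0 = \sum_(k < n.+1)
            (- 'C(n, k)%:R ^+ 2 * 0 + residue R n k * 0)); last first.
    by rewrite big1 // => k _; rewrite !mulr0 addr0.
  apply: cvg_big; first exact: add_continuous.
  move=> k _; apply: cvgD; apply: cvgMl_tmp; first exact: cvg_inv_addr.
  exact: cvg_ln_addr.
rewrite (@integral_itvcy_derive _ _ F _ 0) //.
  rewrite sub0r /F -sumrN /tail_int; congr EFin; apply: eq_bigr => k _.
  rewrite opprD mulNr opprK.
  by rewrite (_ : v%:R + (1 + k%:R) = (v.+1 + k)%:R) // natrD -natr1 addrA.
by move=> t _; exact: sqr_ge0.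
Qed.
End TailIntegral.

(** * The double integral *)

Section DoubleIntegral.
Variable R : realType.
Local Notation mu := (@lebesgue_measure R).
Local Notation I01 := (`[0%R, 1%R]%classic : set R).
Implicit Types (n k v : nat) (x y t u c : R).

(** The term of degree [v] in [x * y] of the geometric expansion of the
    integrand. *)
Definition geo_term n v x y : R :=
  - ((x * y) ^+ v * ((1 - x) * (1 - y)) ^+ n / ln (x * y)).

Lemma measurable_onem_exp n :
  measurable_fun [set: R] (fun x : R => (1 - x) ^+ n).
Proof. by apply: measurable_funX; exact: measurable_funB. Qed.

Lemma measurable_geo_term n v :
  measurable_fun [set: R * R] (fun z : R * R => geo_term n v z.1 z.2).
Proof.
have m12 : measurable_fun [set: R * R] (fun z : R * R => z.1 * z.2).
  exact: measurable_funM.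
apply: measurable_funN; apply: measurable_funM.
  apply: measurable_funM; apply: measurable_funX => //.
  by apply: measurable_funM; apply: measurable_funB.
by apply: measurable_funV; apply: measurableT_comp => //; exact: measurable_ln.
Qed.

Lemma geo_term_ge0 n v x y : I01 x -> I01 y -> 0 <= geo_term n v x y.
Proof.
rewrite /= !in_itv /= => /andP[x0 x1] /andP[y0 y1].
rewrite /geo_term -mulrN -invrN mulr_ge0 ?invr_ge0 ?oppr_ge0 //.
  by rewrite mulr_ge0 // exprn_ge0 // mulr_ge0 // subr_ge0.
by rewrite ln_le0 // mulr_ile1.
Qed.

Lemma beta_kernel_ge0 n t x : I01 x -> 0 <= beta_kernel n t x.
Proof.
rewrite /= in_itv /= => /andP[x0 x1].
by rewrite mulr_ge0 ?powR_ge0 // exprn_ge0 // subr_ge0.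
Qed.

Lemma beta_sum_ge0 n t : 0 < t -> 0 <= beta_sum n t.
Proof.
move=> t0; rewrite -lee_fin -integral_beta_kernel //; apply: integral_ge0 => x xI.
by rewrite lee_fin beta_kernel_ge0.
Qed.

(** This is [- u^v / ln u = \int_v^oo u^t dt] at [u = x * y]. Positivity of [n] and
    [v] makes both sides vanish on the boundary of the square, where
    [u] may be [0] or [1]; hence no null set has to be removed. *)
Lemma integral_beta_kernelM n v x y : (0 < n)%N -> (0 < v)%N -> I01 x -> I01 y ->
  (\int[mu]_(t in `[v%:R, +oo[) (beta_kernel n t x * beta_kernel n t y)%:E
   = (geo_term n v x y)%:E)%E.
Proof.
move=> n0 v0; rewrite /= !in_itv /= => /andP[x0 x1] /andP[y0 y1].
have kE t : beta_kernel n t x * beta_kernel n t y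
            = (x * y) `^ t * ((1 - x) * (1 - y)) ^+ n.
  by rewrite /beta_kernel powRM // exprMn; ring.
under eq_integral do rewrite kE.
have [xy0|xyn0] := eqVneq (x * y) 0.
  rewrite /geo_term xy0 expr0n gtn_eqF //= !mul0r oppr0.
  apply: integral0_eq => t; rewrite /= in_itv /= andbT => vt.
  by rewrite powR0 ?mul0r // gt_eqF // (lt_le_trans _ vt) // ltr0n.
have [c0|cn0] := eqVneq ((1 - x) * (1 - y)) 0.
  rewrite /geo_term c0 expr0n gtn_eqF //= mulr0 mul0r oppr0.
  by apply: integral0_eq => t _; rewrite mulr0.
have xy_gt0 : 0 < x * y by rewrite lt_neqAle eq_sym xyn0 mulr_ge0.
have xy_lt1 : x * y < 1.
  have [x1' y1'] : x < 1 /\ y < 1.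
    move: cn0; rewrite mulf_eq0 !subr_eq0 negb_or !(eq_sym 1).
    rewrite !lt_neqAle x1 y1 !andbT.
    by move/andP.
  by rewrite (le_lt_trans _ x1') // ler_piMr.
rewrite /powR (negbTE xyn0).
under eq_integral do rewrite EFinM.
rewrite ge0_integralZr //=.
- rewrite integral_expR_lt0; last by rewrite ln_lt0 // xy_gt0.
  rewrite -EFinM; congr EFin; rewrite /geo_term.
  rewrite mulr_natl -lnXn // lnK ?posrE ?exprn_gt0 //.
  by ring.
- apply/measurable_EFinP; apply: measurable_funTS.
  by apply: measurableT_comp => //; exact: measurable_funM.
- by rewrite lee_fin exprn_ge0 // mulr_ge0 ?subr_ge0.
Qed.

Lemma measurable_beta_kernel n :
  measurable_fun [set: R * R] (fun z : R * R => beta_kernel n z.2 z.1).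
Proof.
apply: measurable_funM; first exact: measurable_powR_pair.
by apply: (measurableT_comp (measurable_onem_exp n)).
Qed.

Lemma measurable_beta_sum n : measurable_fun [set: R] (@beta_sum R n).
Proof.
apply: measurable_sum => k; apply: measurable_funM => //.
by apply: measurable_funV; do 2 apply: measurable_funD => //.
Qed.

(** Tonelli moves the integral in [t] outside, first past [x], then past [y]; each
    of the two inner integrals contributes a factor [beta_sum n t]. *)
Lemma integral2_geo_term n v : (0 < n)%N -> (0 < v)%N ->
  (\int[mu]_(y in I01) \int[mu]_(x in I01) (geo_term n v x y)%:E
   = (tail_int R n v)%:E)%E.
Proof.
move=> n0 v0; have mI : measurable I01 by [].
have mJ : measurable (`[v%:R, +oo[%classic : set R) by [].
have t_gt0 t : `[v%:R, +oo[%classic t -> 0 < t.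
  by rewrite /= in_itv /= andbT; apply: lt_le_trans; rewrite ltr0n.
rewrite -integral_beta_sum_sqr.
transitivity (\int[mu]_(y in I01) \int[mu]_(t in `[v%:R, +oo[)
                 (beta_sum n t * beta_kernel n t y)%:E)%E.
  apply: eq_integral => y /set_mem yI.
  transitivity (\int[mu]_(x in I01) \int[mu]_(t in `[v%:R, +oo[)
                 (beta_kernel n t x * beta_kernel n t y)%:E)%E.
    by apply: eq_integral => x /set_mem xI; rewrite integral_beta_kernelM.
  rewrite integral_swap //.
  - apply: eq_integral => t /set_mem /t_gt0 t0; under eq_integral do rewrite EFinM.
    rewrite ge0_integralZr //= ?lee_fin ?beta_kernel_ge0 //.
    + by rewrite integral_beta_kernel.
    + apply/measurable_EFinP; apply: measurable_funTS.
      by apply: measurable_funM; [exact: measurable_powR|exact: measurable_onem_exp].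
    + by move=> x xI; rewrite lee_fin beta_kernel_ge0.
  - apply: measurable_funM; first exact: measurable_beta_kernel.
    apply: measurable_funM => //.
    by apply: (measurableT_comp (measurable_powRr y)).
  - by move=> x t xI _; rewrite mulr_ge0 // beta_kernel_ge0.
rewrite (@integral_swap _ _ _ (fun y t => beta_sum n t * beta_kernel n t y)) //.
- apply: eq_integral => t /set_mem /t_gt0 t0; under eq_integral do rewrite EFinM.
  rewrite ge0_integralZl //= ?lee_fin ?beta_sum_ge0 //.
  + by rewrite integral_beta_kernel // expr2 EFinM.
  + apply/measurable_EFinP; apply: measurable_funTS.
    by apply: measurable_funM; [exact: measurable_powR|exact: measurable_onem_exp].
  + by move=> x xI; rewrite lee_fin beta_kernel_ge0.
- apply: measurable_funM; last exact: measurable_beta_kernel.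
  by apply: (measurableT_comp (measurable_beta_sum n)).
- by move=> y t yI /t_gt0 t0; rewrite mulr_ge0 // ?beta_kernel_ge0 ?beta_sum_ge0.
Qed.

(** If [x * y = 1] then [x = y = 1], and both sides are [0] because of the factor
    [(1 - x) ^+ n]; otherwise the series is geometric of ratio [x * y < 1]. *)
Lemma integrand_series n x y : (0 < n)%N -> I01 x -> I01 y ->
  ((integrand n x y)%:E = \sum_(0 <= j <oo) (geo_term n (n + j) x y)%:E)%E.
Proof.
move=> n0; rewrite /= !in_itv /= => /andP[x0 x1] /andP[y0 y1].
have xy_ge0 : 0 <= x * y by rewrite mulr_ge0.
have [xy_lt1|xy1] := ltrP (x * y) 1; last first.
  have -> : x = 1.
    by apply/eqP; rewrite eq_le x1 (le_trans xy1) // ler_piMr.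
  rewrite /integrand subrr mulr0 !mul0r expr0n gtn_eqF //= mul0r oppr0.
  rewrite eseries0 // => j _ _.
  by rewrite /geo_term subrr mul0r expr0n gtn_eqF //= mulr0 mul0r oppr0.
apply/esym/cvg_lim => //; under eq_fun do rewrite sumEFin; apply: cvg_EFin.
  by near=> N.
have h := @cvg_geometric_series R (geo_term n n x y) (x * y).
rewrite (_ : integrand n x y = geo_term n n x y / (1 - x * y)).
  apply: cvg_trans (h _); last by rewrite ger0_norm.
  rewrite /series /=; apply: near_eq_cvg; near=> N.
  by apply: eq_bigr => j _; rewrite /geometric /= /geo_term exprD; ring.
rewrite /integrand /geo_term invfM mulNr; congr (- _).
rewrite -!mulrA [_^-1 * _^-1]mulrC !mulrA -[_ * _ ^+ n]exprMn; congr (_ ^+ n * _ * _).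
by ring.
Unshelve. all: end_near.
Qed.

Lemma integral_integrand n : (0 < n)%N ->
  (\int[mu]_(y in I01) \int[mu]_(x in I01) (integrand n x y)%:E
   = ('C(2 * n, n)%:R * euler_gamma R + log_form R n - harmonic_form R n)%:E)%E.
Proof.
move=> n0; have mI : measurable I01 by [].
transitivity (\int[mu]_(y in I01) \sum_(0 <= j <oo)
                \int[mu]_(x in I01) (geo_term n (n + j) x y)%:E)%E.
  apply: eq_integral => y /set_mem yI; rewrite -integral_nneseries //.
  - by apply: eq_integral => x /set_mem xI; exact: integrand_series.
  - move=> j; apply/measurable_EFinP; apply: measurable_funTS.
    exact: (measurableT_comp (measurable_geo_term n (n + j)) (measurable_pair2 y)).
  - by move=> j x xI; rewrite lee_fin geo_term_ge0.
rewrite integral_nneseries //.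
- under eq_eseriesr do rewrite integral2_geo_term ?addn_gt0 ?n0 //.
  apply/cvg_lim => //; under eq_fun do rewrite sumEFin; apply: cvg_EFin.
    by near=> N.
  exact: cvg_sum_tail_int.
- move=> j.
  apply: (@measurable_integral_section _ _ _ (fun y x => geo_term n (n + j) x y)) => //.
    exact: (measurableT_comp (measurable_geo_term n (n + j)) (@measurable_swap _ _ R R)).
  by move=> y x yI xI; exact: geo_term_ge0.
- move=> j y yI; apply: integral_ge0 => x xI.
  by rewrite lee_fin geo_term_ge0.
Unshelve. all: end_near.
Qed.
End DoubleIntegral.

Theorem theorem1 (R : realType) (n : nat) (hn : (0 < n)%N) :
  (\int[@lebesgue_measure R]_(y in `[0%R, 1%R])
     \int[@lebesgue_measure R]_(x in `[0%R, 1%R]) (integrand n x y)%:E)%E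
    = ('C(2 * n, n)%:R * euler_gamma R + log_form R n - harmonic_form R n)%:E
  /\ (lcm_upto (2 * n))%:R * harmonic_form R n \is a Num.int.
Proof.
by split; [exact: integral_integrand|exact: harmonic_form_int].
Qed.
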